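(* Let $n \ge 1$. There exist constants $C_n > 0$ and $\alpha_n \in (0,1)$, depending only on $n$, such that the following holds. Let $U_1, \ldots, U_n$ be a collection of commuting invertible measure preserving transformations on a probability space $(\Omega, \Sigma, \mu)$, and for $0<\alpha<1$ let $\mathsf{C}^*_{\mathsf{HL}}(\alpha)$ be the sharp Tauberian constant of the associated ergodic (uncentered) Hardy-Littlewood maximal operator $\mathsf{M}^*_{\mathsf{HL}}$. Then \[ \lim_{\alpha \to 1^-} \mathsf{C}^*_{\mathsf{HL}}(\alpha) = 1, \] and in particular \[ \mathsf{C}^*_{\mathsf{HL}}(\alpha) - 1 \le C_n \Big(\frac{1}{\alpha} - 1\Big)^{\frac{1}{n(n+1)}} \qquad \text{for all } \alpha \in (\alpha_n, 1). \]
   Context: A measure preserving transformation $U$ is invertible if it is a bijection of $\Omega$ with $U$ and $U^{-1}$ both measurable and measure preserving; $U^{j}$ for $j<0$ denotes $(U^{-1})^{|j|}$. Let $\mathcal{B}_{\mathsf{HL}}$ be the collection of all open Euclidean balls in $\mathbb{R}^n$ which contain the origin (not necessarily centered there). The ergodic uncentered Hardy-Littlewood maximal operator associated with $U_1,\ldots,U_n$ is defined for $f \in L^1(\Omega)$ by \[ \mathsf{M}^*_{\mathsf{HL}} f(\omega) = \sup_{B \in \mathcal{B}_{\mathsf{HL}}} \frac{1}{\#(B \cap \mathbb{Z}^n)} \sum_{(j_1,\ldots,j_n) \in B \cap \mathbb{Z}^n} |f(U_1^{j_1} \cdots U_n^{j_n}\omega)|, \qquad \omega \in \Omega. \] For $0<\alpha<1$,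 the sharp Tauberian constant is \[ \mathsf{C}^*_{\mathsf{HL}}(\alpha) = \sup_{E \in \Sigma,\ \mu(E)>0} \frac{1}{\mu(E)}\, \mu(\{\omega \in \Omega : \mathsf{M}^*_{\mathsf{HL}} \chi_E(\omega) > \alpha\}), \] where $\chi_E$ is the indicator function of $E$. *)

(* Defs.v *)
From HB Require Import structures.
From mathcomp Require Import all_boot all_order all_algebra.
From mathcomp Require Import finmap.
From mathcomp Require Import all_classical all_reals all_analysis.

Set Implicit Arguments.
Unset Strict Implicit.
Unset Printing Implicit Defensive.

Import Order.TTheory GRing.Theory Num.Theory.
Import numFieldNormedType.Exports.

Local Open Scope classical_set_scope.
Local Open Scope ring_scope.

Section invertible_transformations.
Context {d : measure_display} {T : measurableType d} {R : realType}.

Definition measure_preserving (mu : probability T R) (f : T -> T) : Prop :=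
  measurable_fun [set: T] f /\
  forall A : set T, measurable A -> mu (f @^-1` A) = mu A.

Record invertible_mpt (mu : probability T R) := InvertibleMPT {
  mpt_fun :> T -> T;
  mpt_inv : T -> T;
  mpt_funK : cancel mpt_fun mpt_inv;
  mpt_invK : cancel mpt_inv mpt_fun;
  mpt_fun_preserving : measure_preserving mu mpt_fun;
  mpt_inv_preserving : measure_preserving mu mpt_inv }.

(* Recall that [Negz k] is the integer [- k.+1]. *)
Definition mpt_iter (mu : probability T R) (U : invertible_mpt mu) (j : int)
    : T -> T :=
  match j with
  | Posz k => iter k U
  | Negz k => iter k.+1 (mpt_inv U)
  end.

(* The composite is taken in index order, the map of index 0 being applied
   last. *)
Definition mpt_multi_iter (mu : probability T R) (n : nat)
    (U : 'I_n -> invertible_mpt mu) (j : 'rV[int]_n) : T -> T :=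
  \big[(fun f g : T -> T => f \o g)/(fun x : T => x)]_(i < n)
    mpt_iter (U i) (j 0 i).

End invertible_transformations.

(* The library norm on ['rV[R]_n] is the sup norm, so its [ball] cannot be
   used for Euclidean balls. *)
Definition euclidean_norm {R : realType} {n : nat} (x : 'rV[R]_n) : R :=
  Num.sqrt (\sum_(i < n) x 0 i ^+ 2).

Definition euclidean_ball {R : realType} {n : nat} (c : 'rV[R]_n) (r : R)
    : set 'rV[R]_n :=
  [set x | euclidean_norm (x - c) < r].

Definition balls_HL (R : realType) (n : nat) : set (set 'rV[R]_n) :=
  [set B | B 0 /\
    exists (c : 'rV[R]_n) (r : R), 0 < r /\ B = euclidean_ball c r].

Definition lattice_points {R : realType} {n : nat} (B : set 'rV[R]_n)
    : set 'rV[int]_n :=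
  [set j | B (map_mx intr j)].

Section maximal_operator.
Context {d : measure_display} {T : measurableType d} {R : realType}.
Variables (mu : probability T R) (n : nat) (U : 'I_n -> invertible_mpt mu).

(* [fset_set] and the sum over a set have their intended meaning for finite
   sets only; the lattice points of a ball are finite in number. *)
Definition ergodic_average (B : set 'rV[R]_n) (f : T -> R) (x : T) : R :=
  #|` fset_set (lattice_points B)|%fset%:R^-1 *
  \sum_(j \in lattice_points B) `|f (mpt_multi_iter U j x)|.

Definition maximal_HL (f : T -> R) (x : T) : \bar R :=
  ereal_sup [set (ergodic_average B f x)%:E | B in @balls_HL R n].

Definition tauberian_HL (alpha : R) : \bar R :=
  ereal_sup
    [set (mu [set x | (alpha%:E < maximal_HL (\1_E) x)%E] / mu E)%E
       | E in [set E : set T | measurable E /\ (0 < mu E)%E]].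

End maximal_operator.

(* Main.v *)
(* After transference to orbits, one must bound the union of finitely many
   balls whose lattice points lie in E up to a small proportion.  Process the
   balls by decreasing radius and keep a ball only if a fixed proportion of its
   lattice points is new.  The kept balls are then mostly filled by E, and every
   discarded ball lies in the union of slight enlargements of the kept ones.  It
   remains to see that enlarging all the balls of a finite family by a factor
   1 + O(1/k) multiplies the number of lattice points of their union by at most
   (k/(k-1))^n.  In the continuous setting this follows by contracting each
   power cell of the family towards the center of its ball: the contracted cells
   stay disjoint.  This can be done on lattice points: if a point y of
   (k-1)^-1 Z^n belongs to the power cell of a center x in Z^n, its contraction
   by the factor (k-1)/k is ((k-1) y + x) / k, a point of k^-1 Z^n, and this map
   is injective.  Taking k of order (1/alpha - 1)^(-1/(n+1)) balances the two
   errors; balls of radius less than 6kn have so few lattice points that all of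
   them, the origin included, lie in E. *)

Require Import Defs.
From HB Require Import structures.
From mathcomp Require Import all_boot all_order all_algebra.
From mathcomp Require Import finmap zify ring lra.
From mathcomp Require Import all_classical all_reals all_analysis.
From mathcomp Require Import measurable_realfun.

Set Implicit Arguments.
Unset Strict Implicit.
Unset Printing Implicit Defensive.

Import Order.TTheory GRing.Theory Num.Theory.
Import numFieldNormedType.Exports.

Local Open Scope classical_set_scope.
Local Open Scope ring_scope.

(** * Euclidean norm *)

Section euclidean.
Context {R : realType} {n : nat}.
Implicit Types (x y c : 'rV[R]_n) (a : R).

(** Lagrange's identity: twice the defect is the sum over [i] and [j] of the squares of
    [x 0 i * y 0 j - x 0 j * y 0 i]. *)
Lemma cauchy_schwarz_row x y :
  (\sum_i x 0 i * y 0 i) ^+ 2 <= (\sum_i x 0 i ^+ 2) * (\sum_i y 0 i ^+ 2).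
Proof.
rewrite -(ler_pMn2r (ltn0Sn 1)) -subr_ge0.
suff -> : (\sum_i x 0 i ^+ 2) * (\sum_i y 0 i ^+ 2) *+ 2 -
    (\sum_i x 0 i * y 0 i) ^+ 2 *+ 2 =
    \sum_i \sum_j (x 0 i * y 0 j - x 0 j * y 0 i) ^+ 2.
  by do 2! apply: sumr_ge0 => ? _; exact: sqr_ge0.
rewrite !mulr2n [X in X + _ - _]mulrC {1}[X in _ + X - _]mulrC.
rewrite !expr2 !big_distrlr /=.
rewrite [X in X + _ - _]exchange_big /= -!big_split -sumrB /=.
apply: eq_bigr => i _; rewrite -!big_split -sumrB /=.
by apply: eq_bigr => j _; ring.
Qed.

Lemma sum_sqr_ge0 x : 0 <= \sum_i x 0 i ^+ 2.
Proof. by apply: sumr_ge0 => i _; exact: sqr_ge0. Qed.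

Lemma euclidean_norm_ge0 x : 0 <= euclidean_norm x.
Proof. exact: sqrtr_ge0. Qed.

Lemma sqr_euclidean_norm x : euclidean_norm x ^+ 2 = \sum_i x 0 i ^+ 2.
Proof. by rewrite sqr_sqrtr// sum_sqr_ge0. Qed.

Lemma euclidean_norm_triangle x y :
  euclidean_norm (x + y) <= euclidean_norm x + euclidean_norm y.
Proof.
have nx := euclidean_norm_ge0 x; have ny := euclidean_norm_ge0 y.
rewrite -(ler_pXn2r (ltn0Sn 1)) ?nnegrE ?euclidean_norm_ge0 ?addr_ge0//.
rewrite sqrrD !sqr_euclidean_norm.
have -> : \sum_i (x + y) 0 i ^+ 2 =
    \sum_i x 0 i ^+ 2 + (\sum_i x 0 i * y 0 i) *+ 2 + \sum_i y 0 i ^+ 2.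
  rewrite -sumrMnl -!big_split /=; apply: eq_bigr => i _.
  by rewrite !mxE sqrrD.
rewrite lerD2r lerD2l ler_pMn2r//.
apply: le_trans (ler_norm _) _.
rewrite -(ler_pXn2r (ltn0Sn 1)) ?nnegrE ?mulr_ge0// exprMn.
rewrite real_normK ?num_real//.
by rewrite !sqr_euclidean_norm cauchy_schwarz_row.
Qed.

Lemma euclidean_normZ a x : euclidean_norm (a *: x) = `|a| * euclidean_norm x.
Proof.
rewrite /euclidean_norm -(sqrtr_sqr a) -sqrtrM ?sqr_ge0//.
rewrite mulr_sumr; congr Num.sqrt; apply: eq_bigr => i _.
by rewrite !mxE exprMn.
Qed.

Lemma euclidean_norm0 : euclidean_norm (0 : 'rV[R]_n) = 0.
Proof. by rewrite -(scale0r 0) euclidean_normZ normr0 mul0r. Qed.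

Lemma euclidean_normN x : euclidean_norm (- x) = euclidean_norm x.
Proof. by rewrite -scaleN1r euclidean_normZ normrN1 mul1r. Qed.

Lemma euclidean_dist_triangle y x z :
  euclidean_norm (x - z) <= euclidean_norm (x - y) + euclidean_norm (y - z).
Proof. by rewrite -[x - z](subrKA y) euclidean_norm_triangle. Qed.

Lemma coord_le_euclidean_norm x i : `|x 0 i| <= euclidean_norm x.
Proof.
rewrite -sqrtr_sqr; apply: ler_wsqrtr; rewrite (bigD1 i)//= lerDl.
by apply: sumr_ge0 => ? _; exact: sqr_ge0.
Qed.

(** The sharp factor is the square root of [n]; the cruder factor [n] keeps the radii below natural
    multiples and affects constants only. *)
Lemma euclidean_norm_lt x a :
  (forall i, `|x 0 i| < a) -> (0 < n)%N -> euclidean_norm x < n%:R * a.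
Proof.
move=> xa n0; pose i0 := Ordinal n0.
have a0 : 0 < a := le_lt_trans (normr_ge0 _) (xa i0).
have xa2 i : x 0 i ^+ 2 < a ^+ 2.
  by rewrite -(real_normK (num_real _)) ltr_pXn2r ?nnegrE// ltW.
rewrite -(ltr_pXn2r (ltn0Sn 1)) ?nnegrE ?euclidean_norm_ge0 ?mulr_ge0// 1?ltW//.
rewrite sqr_euclidean_norm (@lt_le_trans _ _ (n%:R * a ^+ 2))//.
  rewrite -[X in X%:R](card_ord n) mulr_natl -sumr_const.
  rewrite (bigD1 i0)//= [ltRHS](bigD1 i0)//= ltr_leD//.
  by apply: ler_sum => i _; exact: ltW.
by rewrite exprMn ler_wpM2r ?sqr_ge0// -natrX ler_nat; nia.
Qed.

End euclidean.

(** * Counting lattice points *)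

Section boxes.
Context {n : nat}.
Implicit Types (a j : 'rV[int]_n) (m : nat) (A : {fset 'rV[int]_n}).

Definition box a m : {fset 'rV[int]_n} :=
  [fset (a + \row_i (f i)%:Z)%R | f : {ffun 'I_n -> 'I_m} in predT]%fset.

Lemma mem_box a m j :
  (j \in box a m) = [forall i, a 0 i <= j 0 i < a 0 i + m%:Z].
Proof.
apply/imfsetP/forallP => /= [[f _ ->] i|jP].
  by rewrite !mxE lerDl ltrD2l lez_nat ltz_nat ltn_ord.
have jm i : (absz (j 0 i - a 0 i)%R < m)%N.
    by case/andP: (jP i); lia.
exists [ffun i => Ordinal (jm i)] => //; apply/rowP => i.
by rewrite !mxE ffunE /=; case/andP: (jP i); lia.
Qed.

Lemma card_box a m : #|` box a m| = (m ^ n)%N.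
Proof.
rewrite card_imfset /=; last first.
  move=> f g /addrI/rowP fg; apply/ffunP => i; apply: val_inj.
  by move: (fg i); rewrite !mxE => -[].
by rewrite -cardE card_ffun !card_ord.
Qed.

(* By [mem_dilate], the union of the cells [y * m + [0, m)^n] for [y] in [A]. *)
Definition dilate m A : {fset 'rV[int]_n} :=
  [fset x in [seq (y *+ m + f)%R | y <- A, f <- box 0 m]]%fset.

Lemma divz_rowE m j y f : f \in box 0 m -> j = y *+ m + f ->
  y = \row_i divz (j 0 i) m.
Proof.
rewrite mem_box => /forallP fP ->; apply/rowP => i; move: (fP i).
rewrite !mxE add0r mulmxnE -mulr_natr natz => /andP[f0 fm].
by rewrite divzMDl ?divz_small ?addr0// ?normr_nat ?f0//; lia.
Qed.

Lemma mem_dilate m A j : (0 < m)%N ->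
  (j \in dilate m A) = (\row_i divz (j 0 i) m \in A).
Proof.
move=> m0; rewrite inE; apply/allpairsP/idP => /= [[[y f] /= [yA fm]]|jA].
  by move=> /(divz_rowE fm) <-.
exists (\row_i divz (j 0 i) m, \row_i modz (j 0 i) m); split => //=.
  rewrite mem_box; apply/forallP => i.
  by rewrite !mxE add0r modz_ge0 ?ltz_pmod//; lia.
apply/rowP => i; rewrite /= !mxE mulmxnE mxE -mulr_natr natz.
by rewrite -divz_eq.
Qed.

Lemma card_dilate m A : #|` dilate m A| = (#|` A| * m ^ n)%N.
Proof.
rewrite card_fseq undup_id ?size_allpairs ?card_box//.
apply: allpairs_uniq => //; rewrite ?fset_uniq// => -[y f] [y' f'].
move=> /allpairsP[[? ?] /= [_ fm [-> ->]]].
move=> /allpairsP[[? ?] /= [_ f'm [-> ->]]] e.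
have yy' := etrans (divz_rowE fm erefl) (esym (divz_rowE f'm e)).
by move: e; rewrite yy' => /addrI ->.
Qed.

End boxes.

(** * Lattice points of Euclidean balls, compared with boxes *)

Section lattice_balls.
Context {R : realType} {n : nat}.
Hypothesis n_gt0 : (0 < n)%N.
Implicit Types (c : 'rV[R]_n) (r : R) (j : 'rV[int]_n).

Definition floor_row c : 'rV[int]_n := \row_i Num.floor (c 0 i).

Definition lattice_ball c r : {fset 'rV[int]_n} :=
  fset_set (lattice_points (euclidean_ball c r)).

(** Each coordinate ranges over an interval of length [2 * r]; rounding its left end down costs at
    most one more unit. *)
Lemma lattice_points_sub_box c r (m : nat) : 2 * r + 1 <= m%:R ->
  lattice_points (euclidean_ball c r) `<=`
  [set` box (\row_i Num.floor (c 0 i - r)) m].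
Proof.
move=> rm j; rewrite /lattice_points /euclidean_ball /= => jc.
rewrite mem_box; apply/forallP => i; rewrite mxE.
have := le_lt_trans (coord_le_euclidean_norm _ i) jc.
rewrite !mxE ltr_norml => /andP[j1 j2].
have /andP[f1 f2] := floor_itv (c 0 i - r).
apply/andP; split.
  by rewrite -(@ler_int R) (le_trans f1)//; lra.
by rewrite -(@ltr_int R) intrD -pmulrn; move: f2; rewrite intrD; lra.
Qed.

Lemma finite_lattice_points c r :
  finite_set (lattice_points (euclidean_ball c r)).
Proof.
have rm : 2 * r + 1 <= (Num.trunc (2 * r + 1)).+1%:R.
  by rewrite ltW// truncnS_gt.
by apply: sub_finite_set (lattice_points_sub_box rm) _; exact: finite_fset.
Qed.

Lemma mem_lattice_ball c r j :
  (j \in lattice_ball c r) = (euclidean_norm (map_mx intr j - c) < r).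
Proof.
by rewrite in_fset_set ?mem_setE//; exact: finite_lattice_points.
Qed.

Lemma card_lattice_ball_le c r (m : nat) :
  2 * r + 1 <= m%:R -> (#|` lattice_ball c r| <= m ^ n)%N.
Proof.
move=> rm; rewrite -(card_box (\row_i Num.floor (c 0 i - r))).
apply/fsubset_leq_card/fsubsetP => j.
rewrite in_fset_set ?inE; last exact: finite_lattice_points.
exact: lattice_points_sub_box.
Qed.

Lemma box_sub_lattice_ball c r (m : nat) : (0 < m)%N -> n%:R * m%:R <= r ->
  (box (floor_row c) m `<=` lattice_ball c r)%fset.
Proof.
move=> m0 mr; apply/fsubsetP => j; rewrite mem_box => /forallP jP.
rewrite mem_lattice_ball (lt_le_trans _ mr)//; apply: euclidean_norm_lt => // i.
have := jP i; rewrite !mxE => /andP[j1 j2].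
have /andP[f1 f2] := floor_itv (c 0 i).
have m1 : 1 <= m%:R :> R by rewrite ler1n.
move: j1; rewrite -(@ler_int R) => j1.
have : (j 0 i + 1)%:~R <= (Num.floor (c 0 i) + m%:Z)%:~R :> R.
  by rewrite ler_int lezD1.
rewrite !intrD -pmulrn => j3; move: f2; rewrite intrD => f2.
by rewrite ltr_norml; apply/andP; split; lra.
Qed.

Lemma floor_row_dist c : euclidean_norm (map_mx intr (floor_row c) - c) < n%:R.
Proof.
rewrite -mem_lattice_ball.
have /fsubsetP : (box (floor_row c) 1 `<=` lattice_ball c n%:R)%fset.
  by apply: box_sub_lattice_ball; rewrite ?mulr1.
by apply; rewrite mem_box; apply/forallP => i; lia.
Qed.

End lattice_balls.

(** * Absorption of an almost covered ball by enlarged larger balls *)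

Section ball_unions.
Context {R : realType} {n : nat}.
Hypothesis n_gt0 : (0 < n)%N.
Implicit Types (c : 'rV[R]_n) (r t : R) (s : seq ('rV[R]_n * R)) (k : nat).

Definition ball_union s : {fset 'rV[int]_n} :=
  (\bigcup_(b <- s) lattice_ball b.1 b.2)%fset.

Lemma ball_unionP s j :
  reflect (exists2 b, b \in s & euclidean_norm (map_mx intr j - b.1) < b.2)
    (j \in ball_union s).
Proof.
apply: (iffP (bigfcupP _ _ _ _)) => -[b].
  by rewrite andbT mem_lattice_ball => bs jb; exists b.
by move=> bs jb; exists b; rewrite ?andbT ?mem_lattice_ball.
Qed.

Definition enlarge t s := [seq (b.1, t * b.2) | b <- s].

Lemma ball_union_enlargeP t s j :
  reflect
    (exists2 b, b \in s & euclidean_norm (map_mx intr j - b.1) < t * b.2)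
    (j \in ball_union (enlarge t s)).
Proof.
apply: (iffP (ball_unionP _ _)) => -[b].
  by move=> /mapP[b' b's ->] /= jb; exists b'.
by move=> bs jb; exists (b.1, t * b.2) => //; exact: map_f.
Qed.

(** Near each point [x] of the ball, some box inside the ball has more points than the ball has
    uncovered ones. So a point of the box, at distance less than [r / (3k)] from [x], lies in a ball
    of [s], and the radius of that ball is at least [r]. *)
Lemma lattice_ball_sub_enlarge k s c r : (0 < k)%N -> (6 * k * n)%:R <= r ->
  (forall b, b \in s -> r <= b.2) ->
  ((36 * k * n) ^ n * #|` (lattice_ball c r `\` ball_union s)%fset| <
    #|` lattice_ball c r|)%N ->
  (lattice_ball c r `<=` ball_union (enlarge (1 + (3 * k%:R)^-1) s))%fset.
Proof.
move=> k0 rk sr few; apply/fsubsetP => x; rewrite mem_lattice_ball => xc.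
pose q := (6 * k * n)%N; have q0 : (0 < q)%N by rewrite /q; nia.
have q0R : 0 < q%:R :> R by rewrite ltr0n.
have r0 : 0 < r by apply: lt_le_trans rk; rewrite ltr0n.
have k0R : 0 < k%:R :> R by rewrite ltr0n.
(* The side of a lattice box that fits into a ball of radius [r / (6k)]; it is positive because
   [r >= 6kn]. *)
pose M := Num.trunc (r / q%:R).
have M0 : (0 < M)%N by rewrite truncn_gt0 ler_pdivlMr ?mul1r.
have /andP[M1 M2] := truncn_itv (divr_ge0 (ltW r0) (ltW q0R)).
rewrite -/M ler_pdivlMr// in M1; rewrite -/M ltr_pdivrMr// in M2.
pose eta : R := (6 * k%:R)^-1.
have eta0 : 0 < eta by rewrite invr_gt0 mulr_gt0.
have eta1 : eta <= 1.
  by rewrite invf_le1 ?mulr_gt0// -natrM ler1n muln_gt0.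
have etaE : eta * (6 * k%:R) = 1 by rewrite mulVf// gt_eqF// mulr_gt0.
have t2 : (3 * k%:R)^-1 = 2 * eta.
  by rewrite /eta; field; rewrite ?gt_eqF.
have MD : (#|` (lattice_ball c r `\` ball_union s)%fset| < M ^ n)%N.
  have cardL : (#|` lattice_ball c r| <= (36 * k * n * M) ^ n)%N.
    apply: card_lattice_ball_le.
    (* Since [r < (M + 1) * q], the left side bounds [2 * r + 1]; the right side is [6 * q * M], and
       [M >= 1]. *)
    have : (2 * (M.+1 * q) + 1 <= 36 * k * n * M)%N by rewrite /q; nia.
    rewrite -(ler_nat R) natrD 2!natrM => /(le_trans _); apply.
    by rewrite lerD2r ler_pM2l// ltW.
  have := leq_trans few cardL.
  by rewrite (expnMn _ M) ltn_pmul2l// expn_gt0; nia.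
pose y : 'rV[R]_n := map_mx intr x.
(* Moving [x] towards the center by the fraction [eta = 1 / (6k)] leaves room for a ball of radius
   [eta * r] inside the given one. *)
pose p := y + eta *: (c - y).
have yp : euclidean_norm (y - p) < eta * r.
  rewrite /p opprD addrA subrr add0r euclidean_normN euclidean_normZ.
  rewrite gtr0_norm//.
  by rewrite ltr_pM2l// -opprB euclidean_normN.
have pc : euclidean_norm (p - c) <= (1 - eta) * r.
  have -> : p - c = (1 - eta) *: (y - c).
    by apply/rowP => i; rewrite !mxE; ring.
  by rewrite euclidean_normZ ger0_norm ?subr_ge0// ler_wpM2l ?subr_ge0// ltW.
have boxp : (box (floor_row p) M `<=` lattice_ball p (eta * r))%fset.
  apply: box_sub_lattice_ball => //.
  rewrite -(@ler_pM2l _ (6 * k%:R)) ?mulr_gt0//.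
  rewrite [leRHS]mulrA [_ * eta]mulrC etaE mul1r.
  by move: M1; rewrite /q !natrM; lra.
have [z zb zs] : exists2 z, z \in box (floor_row p) M & z \in ball_union s.
  apply: contrapT => noz; move: MD; rewrite ltnNge => /negP; apply.
  rewrite -(card_box (floor_row p)); apply/fsubset_leq_card/fsubsetP => z zb.
  rewrite inE; apply/andP; split.
    by apply/negP => zs; apply: noz; exists z.
  move/fsubsetP/(_ _ zb): boxp; rewrite !mem_lattice_ball => zp.
  by have := euclidean_dist_triangle p (map_mx intr z) c; lra.
move/fsubsetP/(_ _ zb): boxp; rewrite mem_lattice_ball => zp.
have /ball_unionP[b bs zb'] := zs.
apply/ball_union_enlargeP; exists b => //; rewrite t2.
have := euclidean_dist_triangle p y b.1.
have := euclidean_dist_triangle (map_mx intr z) p b.1.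
rewrite -(euclidean_normN (p - map_mx intr z)) opprB.
have : eta * r <= eta * b.2 by rewrite ler_wpM2l// ?sr// ltW.
by lra.
Qed.

End ball_unions.

(** * Enlarging a family of balls *)

Lemma seq_arg_min (R : realType) (I : eqType) (s : seq I) (F : I -> R) :
  s != [::] -> exists2 b, b \in s & forall b', b' \in s -> F b <= F b'.
Proof.
elim: s => // a [_ _|b s IH _].
  by exists a => [|b']; rewrite inE // => /eqP ->.
have [//|c cs cP] := IH.
have [ac|ca] := leP (F a) (F c).
  exists a => [|b']; rewrite inE ?eqxx// => /predU1P[->//|/cP].
  exact: le_trans.
exists c => [|b']; rewrite inE ?cs ?orbT// => /predU1P[->|/cP//].
exact: ltW.
Qed.

Section dilation.
Context {R : realType} {n : nat}.
Hypothesis n_gt0 : (0 < n)%N.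
Implicit Types (c : 'rV[R]_n) (s : seq ('rV[R]_n * R)) (k : nat).
Implicit Types (j x : 'rV[int]_n).

Local Notation toR j := (map_mx intr j : 'rV[R]_n).

Lemma divz_row_dist j (m : nat) : (0 < m)%N ->
  euclidean_norm (toR j - m%:R *: toR (\row_i divz (j 0 i) m)) < n%:R * m%:R.
Proof.
move=> m0; apply: euclidean_norm_lt => // i.
rewrite !mxE [in X in X - _](divz_eq (j 0 i) m) intrD intrM -pmulrn.
rewrite [_ * m%:R]mulrC addrAC subrr add0r.
rewrite ger0_norm ?ler0z ?modz_ge0//; last by lia.
by rewrite pmulrn ltr_int ltz_pmod.
Qed.

(* [m ^ 2] times the power of the point [j / m] with respect to the ball of
   radius [b.2] around the lattice point [floor_row b.1]. *)
Definition power_fun (m : R) (b : 'rV[R]_n * R) j : R :=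
  euclidean_norm (toR j - m *: toR (floor_row b.1)) ^+ 2 - (m * b.2) ^+ 2.

(** The difference of two power functions is affine in the point, so adding the two hypotheses
    cancels the radii. Sending a point to the center of its cell is monotone, like the gradient of a
    convex function. *)
Lemma power_cell_monotone (m : R) b b' j j' : 0 < m ->
  power_fun m b j <= power_fun m b' j ->
  power_fun m b' j' <= power_fun m b j' ->
  0 <= \sum_i (toR j - toR j') 0 i *
              (toR (floor_row b.1) - toR (floor_row b'.1)) 0 i.
Proof.
move=> m0 jb j'b'; rewrite -(pmulr_rge0 _ (mulr_gt0 (ltr0Sn R 1) m0)).
have -> : (2 * m) * (\sum_i (toR j - toR j') 0 i *
    (toR (floor_row b.1) - toR (floor_row b'.1)) 0 i) =
    (power_fun m b' j - power_fun m b j) +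
    (power_fun m b j' - power_fun m b' j').
  rewrite /power_fun !sqr_euclidean_norm !opprB.
  rewrite [RHS](_ : _ =
    \sum_i (toR j - m *: toR (floor_row b'.1)) 0 i ^+ 2 -
    \sum_i (toR j - m *: toR (floor_row b.1)) 0 i ^+ 2 +
    (\sum_i (toR j' - m *: toR (floor_row b.1)) 0 i ^+ 2 -
    \sum_i (toR j' - m *: toR (floor_row b'.1)) 0 i ^+ 2)); last by ring.
  rewrite -!sumrB -big_split /= mulr_sumr; apply: eq_bigr => i _.
  by rewrite !mxE; ring.
by rewrite addr_ge0// subr_ge0.
Qed.

(** If two images agree, the centers differ by the opposite of [j - j'], and monotonicity makes
    minus the squared norm of [j - j'] nonnegative. *)
Lemma translate_injective (m : R) (sel : 'rV[int]_n -> 'rV[R]_n * R) : 0 < m ->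
  (forall j j', power_fun m (sel j) j <= power_fun m (sel j') j) ->
  injective (fun j => j + floor_row (sel j).1).
Proof.
move=> m0 selP j j' /= e.
have := power_cell_monotone m0 (selP j j') (selP j' j).
have -> : toR (floor_row (sel j).1) - toR (floor_row (sel j').1) =
    - (toR j - toR j').
  apply/rowP => i; move/rowP/(_ i)/(congr1 (fun z : int => z%:~R : R)): e.
  by rewrite !mxE !intrD; lra.
under eq_bigr do rewrite [X in _ * X]mxE mulrN -expr2.
rewrite sumrN oppr_ge0 => sum0.
have /eqP := le_anti (introT andP (conj sum0 (sum_sqr_ge0 _))).
rewrite psumr_eq0 => [|i _]; last exact: sqr_ge0.
move=> /allP sum0'; apply/rowP => i.
have := sum0' i (mem_index_enum _); rewrite /= sqrf_eq0 !mxE subr_eq0.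
by rewrite eqr_int => /eqP.
Qed.

(** A point [j] of the [k.-1]-dilate of the enlarged union stands for [j / (k - 1)], and [h j] for
    its contraction, on the grid of mesh [1 / k]. The injection [h] lands in the [k]-dilate of the
    original union; the dilates carry the factors [k.-1 ^ n] and [k ^ n]. *)
Lemma card_ball_union_enlarge k s : (1 < k)%N ->
  (forall b, b \in s -> (6 * k * n)%:R <= b.2) ->
  (k.-1 ^ n * #|` ball_union (enlarge (1 + (3 * k%:R)^-1) s)| <=
   k ^ n * #|` ball_union s|)%N.
Proof.
move=> k1 sr; have [->|s0] := eqVneq s [::].
  by rewrite /= /ball_union big_nil cardfs0 !muln0.
pose t : R := 1 + (3 * k%:R)^-1.
have k'0 : (0 < k.-1)%N by lia.
have k'0R : 0 < k.-1%:R :> R by rewrite ltr0n.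
have k0 : (0 < k)%N by lia.
have k0R : 0 < k%:R :> R by rewrite ltr0n.
have k'E : k.-1%:R = k%:R - 1 :> R by rewrite -subn1 natrB.
have tk : t * (3 * k%:R) = 3 * k%:R + 1.
  by rewrite /t mulrDl mul1r mulVf// gt_eqF// mulr_gt0.
(* The extra [2n] absorbs two roundings, each by less than [n]: of the center to [floor_row b.1],
   and of [j / (k - 1)] down to a lattice point. *)
pose s' := [seq (b.1, t * b.2 + 2 * n%:R) | b <- s].
have /boolp.choice[sel selP] j : exists b, b \in s' /\
    forall b', b' \in s' -> power_fun k.-1%:R b j <= power_fun k.-1%:R b' j.
  have [|b bs bP] := @seq_arg_min R _ s' (power_fun k.-1%:R ^~ j).
    by rewrite -size_eq0 size_map size_eq0.
  by exists b.
set A := ball_union (enlarge _ _).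
pose h j := j + floor_row (sel j).1.
have hinj : injective h.
  apply: translate_injective k'0R _ => j j'.
  by case: (selP j) => _; apply; case: (selP j').
have hcard : #|` [fset h j | j in dilate k.-1 A]%fset| = #|` dilate k.-1 A|.
  by rewrite card_imfset.
rewrite mulnC -card_dilate [leqRHS]mulnC -card_dilate -hcard.
apply/fsubset_leq_card/fsubsetP => _ /imfsetP[j /= jA ->].
move: jA; rewrite !mem_dilate// => /ball_union_enlargeP[b bs jb].
have r0 (b0 : 'rV[R]_n * R) : b0 \in s -> 0 <= t * b0.2 + 2 * n%:R.
  move=> /sr /(le_trans (ler0n _ _)) b0r.
  by rewrite addr_ge0 ?mulr_ge0// /t addr_ge0 ?invr_ge0 ?mulr_ge0.
have floorZ (v : 'rV[R]_n) : euclidean_norm (v - toR (floor_row v)) < n%:R.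
  by rewrite -euclidean_normN opprB floor_row_dist.
(* [j / (k - 1)] lies in some padded ball, where the power is negative; hence so is the least power,
   and the point lies in the selected ball. *)
have selneg : power_fun k.-1%:R (sel j) j < 0.
  have b's : (b.1, t * b.2 + 2 * n%:R) \in s' by apply: map_f.
  have [_ /(_ _ b's)/le_lt_trans] := selP j; apply.
  rewrite /power_fun /= subr_lt0 ltr_pXn2r// ?nnegrE ?euclidean_norm_ge0//;
    last first.
    by rewrite mulr_ge0 ?ler0n ?r0.
  set y := \row_i _ in jb.
  apply: le_lt_trans (euclidean_dist_triangle (k.-1%:R *: toR y) _ _) _.
  have := divz_row_dist j k'0; rewrite -/y => jy.
  rewrite -scalerBr euclidean_normZ gtr0_norm//.
  have yx : euclidean_norm (toR y - toR (floor_row b.1)) < t * b.2 + n%:R.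
    apply: le_lt_trans (euclidean_dist_triangle b.1 _ _) _.
    by rewrite ltrD.
  rewrite -(ltr_pM2l k'0R) in yx.
  by lra.
have [/mapP[b0 b0s selE] _] := selP j.
move: selneg; rewrite /power_fun selE /= subr_lt0.
rewrite ltr_pXn2r// ?nnegrE ?euclidean_norm_ge0 ?mulr_ge0 ?ler0n ?r0// => jx.
apply/ball_unionP; exists b0 => //; set z := \row_i _.
rewrite -(ltr_pM2l k0R) -[X in X * _](gtr0_norm k0R) -euclidean_normZ scalerBr.
apply: le_lt_trans (euclidean_dist_triangle (toR (h j)) _ _) _.
have := divz_row_dist (h j) k0; rewrite -/z -euclidean_normN opprB => zh.
have hjE : toR (h j) - k%:R *: toR (floor_row b0.1) =
    toR j - k.-1%:R *: toR (floor_row b0.1).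
  by apply/rowP => i; rewrite /h selE !mxE intrD k'E; ring.
have hc : euclidean_norm (toR (h j) - k%:R *: b0.1) <
    k.-1%:R * (t * b0.2 + 2 * n%:R) + k%:R * n%:R.
  apply: le_lt_trans
    (euclidean_dist_triangle (k%:R *: toR (floor_row b0.1)) _ _) _.
  rewrite hjE -scalerBr euclidean_normZ gtr0_norm// ltrD// ltr_pM2l//.
  exact: floor_row_dist.
have b0r : 6 * k%:R * n%:R <= b0.2 by rewrite -!natrM sr.
have tkb : t * b0.2 * (3 * k%:R) = (3 * k%:R + 1) * b0.2 by rewrite -tk; ring.
have tb0 : b0.2 <= t * b0.2.
  rewrite ler_peMl ?lerDl ?invr_ge0 ?mulr_ge0//.
  by apply: le_trans b0r; rewrite !mulr_ge0.
have n0 : 0 <= n%:R :> R by [].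
(* Needed: [(k - 1) * (t * r + 2n) + 2kn <= k * r] for [r = b0.2]. As [(k - 1) * t <= k - 2/3], it
   suffices that [4kn <= 2r/3], which is [r >= 6kn]. *)
move: hc; rewrite k'E; lra.
Qed.

End dilation.

(** * Ball selection *)

Section discrete_solyanik.
Context {R : realType} {n : nat}.
Hypothesis n_gt0 : (0 < n)%N.
Implicit Types (s S : seq ('rV[R]_n * R)) (k : nat) (E : {fset 'rV[int]_n}).

Lemma ball_union_cons b s :
  ball_union (b :: s) = (lattice_ball b.1 b.2 `|` ball_union s)%fset.
Proof. by rewrite /ball_union big_cons. Qed.

Lemma ball_union_subset s s' :
  {subset s <= s'} -> (ball_union s `<=` ball_union s')%fset.
Proof.
move=> ss'; apply/fsubsetP => j /ball_unionP[b bs jb].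
by apply/ball_unionP; exists b => //; exact: ss'.
Qed.

(** The list increases in radius, so induction treats the larger balls of the tail before the head.
    A kept head has at least [k] times as many new points as points outside [E], so its deficit is
    paid for by new points alone and the bounds add up. *)
Lemma ball_selection k E s : (0 < k)%N ->
  sorted (fun b b' : 'rV[R]_n * R => b.2 <= b'.2) s ->
  (forall b, b \in s -> (6 * k * n)%:R <= b.2) ->
  (forall b, b \in s -> (k * (36 * k * n) ^ n *
    #|` (lattice_ball b.1 b.2 `\` E)%fset| <= #|` lattice_ball b.1 b.2|)%N) ->
  exists S, [/\ {subset S <= s},
    (ball_union s `<=` ball_union (enlarge (1 + (3 * k%:R)^-1) S))%fset &
    (k * #|` (ball_union S `\` E)%fset| <= #|` ball_union S|)%N].
Proof.
move=> k0; elim: s => [_ _ _|b s IH bs sr sE].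
  exists [::]; split => //.
  by rewrite /ball_union big_nil fset0D cardfs0 muln0.
have sb : all (fun b' : 'rV[R]_n * R => b.2 <= b'.2) s.
  by apply: order_path_min bs => x y z; exact: le_trans.
have {IH}[||S [Ss sS SE]] := IH (path_sorted bs).
- by move=> b' b's; apply: sr; rewrite inE b's orbT.
- by move=> b' b's; apply: sE; rewrite inE b's orbT.
have bE := sE b (mem_head _ _).
set L := lattice_ball b.1 b.2 in bE *; set D := ((36 * k * n) ^ n)%N in bE.
have [few|many] := ltnP (D * #|` (L `\` ball_union S)%fset|) #|` L|.
  exists S; split => //.
    by move=> b' /Ss b's; rewrite inE b's orbT.
  rewrite ball_union_cons fsubUset sS andbT.
  apply: lattice_ball_sub_enlarge few => //; first by rewrite sr ?mem_head.
  by move=> b' /Ss b's; exact: (allP sb).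
exists (b :: S); split.
- by move=> b'; rewrite !inE => /predU1P[->|/Ss ->]; rewrite ?eqxx ?orbT.
- rewrite ball_union_cons fsubUset; apply/andP; split.
    apply/fsubsetP => j; rewrite mem_lattice_ball => jb.
    apply/ball_union_enlargeP; exists b; rewrite ?mem_head//.
    apply: lt_le_trans jb _; rewrite ler_peMl ?lerDl ?invr_ge0 ?mulr_ge0//.
    by apply: le_trans (sr _ (mem_head _ _)).
  apply: fsubset_trans sS _; apply: ball_union_subset => b' b'S.
  by rewrite inE b'S orbT.
rewrite ball_union_cons.
have -> : ((L `|` ball_union S) `\` E =
    (L `\` ball_union S `\` E) `|` (ball_union S `\` E))%fset.
  apply/fsetP => j; rewrite !inE.
  by case: (j \in E); case: (j \in L); case: (j \in ball_union S).
have [+ _] :=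
  leq_card_fsetU (L `\` ball_union S `\` E)%fset (ball_union S `\` E)%fset.
have /fsubset_leq_card : (L `\` ball_union S `\` E `<=` L `\` E)%fset.
  by apply/fsubsetP => j; rewrite !inE => /and3P[-> _ ->].
have -> : (L `|` ball_union S = (L `\` ball_union S) `|` ball_union S)%fset.
  apply/fsetP => j; rewrite !inE.
  by case: (j \in ball_union S); rewrite ?orbT// orbF.
have -> : #|` ((L `\` ball_union S) `|` ball_union S)%fset| =
    (#|` (L `\` ball_union S)%fset| + #|` ball_union S|)%N.
  rewrite -cardfsUI [X in (_ + #|` X|)%N](_ : _ = fset0) ?cardfs0 ?addn0//.
  by apply/fsetP => j; rewrite !inE; case: (j \in ball_union S); rewrite ?andbF.
have D0 : (0 < D)%N by rewrite expn_gt0; nia.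
move: many bE SE; clearbody D.
set w := #|` (L `\` _ `\` E)%fset|; set w' := #|` (L `\` E)%fset|.
set v := #|` (L `\` _)%fset|; set u := #|` (_ `\` E)%fset|.
set x := #|` ball_union S|.
set l := #|` L|; move=> h1 h2 h3 h4 h5.
have h6 : (k * w' <= v)%N.
  rewrite -(leq_pmul2l D0); apply: leq_trans (leq_trans h2 h1).
  by rewrite mulnA [(D * k)%N]mulnC.
nia.
Qed.

(** Of the [n + 1] factors [k / (k - 1)], [n] come from the enlargement and one from the deficit of
    the kept balls in [E]. *)
Lemma discrete_solyanik k E s : (1 < k)%N ->
  (forall b, b \in s -> (6 * k * n)%:R <= b.2) ->
  (forall b, b \in s -> (k * (36 * k * n) ^ n *
    #|` (lattice_ball b.1 b.2 `\` E)%fset| <= #|` lattice_ball b.1 b.2|)%N) ->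
  (k.-1 ^ n.+1 * #|` (E `|` ball_union s)%fset| <= k ^ n.+1 * #|` E|)%N.
Proof.
move=> k1 sr sE; have k0 : (0 < k)%N by lia.
pose le2 := fun b b' : 'rV[R]_n * R => b.2 <= b'.2.
have [||| S [Ss sS SE]] := @ball_selection k E (sort le2 s) k0.
- by apply: sort_sorted => b b'; exact: le_total.
- by move=> b; rewrite mem_sort; exact: sr.
- by move=> b; rewrite mem_sort; exact: sE.
have Ss' b : b \in S -> b \in s by move=> /Ss; rewrite mem_sort.
have h1 : (k.-1 ^ n * #|` ball_union s| <= k ^ n * #|` ball_union S|)%N.
  apply: leq_trans (card_ball_union_enlarge n_gt0 k1 _); last first.
    by move=> b /Ss'/sr.
  rewrite leq_mul2l fsubset_leq_card ?orbT//; apply: fsubset_trans sS.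
  by apply: ball_union_subset => b; rewrite mem_sort.
have /fsubset_leq_card h2 : (ball_union S `&` E `<=` E `&` ball_union s)%fset.
  by rewrite fsetIC; apply: fsetIS; exact: ball_union_subset.
have h3 := cardfsID E (ball_union S).
have h4 := cardfsUI E (ball_union s).
have h5 : (#|` (E `&` ball_union s)%fset| <= #|` E|)%N.
  exact/fsubset_leq_card/fsubsetIl.
have h6 : (k.-1 * #|` ball_union S| <= k * #|` (E `&` ball_union s)%fset|)%N.
  nia.
have h7 : (k.-1 ^ n.+1 * #|` ball_union s| <=
    k ^ n.+1 * #|` (E `&` ball_union s)%fset|)%N.
  rewrite !expnS -mulnA (leq_trans (leq_mul (leqnn _) h1))//.
  by rewrite mulnCA -[leqRHS]mulnA [leqRHS]mulnCA leq_mul2l h6 orbT.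
have h8 : (k.-1 ^ n.+1 <= k ^ n.+1)%N by rewrite leq_exp2r// leq_pred.
(* Points of [E] outside the balls enter both sides, with the smaller factor on the left by [h8]. *)
nia.
Qed.

End discrete_solyanik.

(** * Transference to orbits *)

Section action.
Context {d : measure_display} {T : measurableType d} {R : realType}.
Variables (mu : probability T R).
Implicit Types (V : invertible_mpt mu) (f g : T -> T).

Lemma measure_preserving_id : measure_preserving mu (fun x => x).
Proof. by split => // A mA; exact: measurable_id. Qed.

Lemma measure_preserving_comp f g :
  measure_preserving mu f -> measure_preserving mu g ->
  measure_preserving mu (f \o g).
Proof.
move=> [mf pf] [mg pg]; split; first exact: measurableT_comp.
move=> A mA; rewrite comp_preimage pg ?pf//.
by rewrite -[X in measurable X]setTI; exact: mf.
Qed.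

Lemma measure_preserving_iter f k :
  measure_preserving mu f -> measure_preserving mu (iter k f).
Proof.
move=> pf; elim: k => [|k IH]; first exact: measure_preserving_id.
by have := measure_preserving_comp pf IH.
Qed.

Lemma measure_preserving_mpt_iter V (a : int) :
  measure_preserving mu (mpt_iter V a).
Proof.
by case: a => k; apply: measure_preserving_iter;
  [exact: mpt_fun_preserving|exact: mpt_inv_preserving].
Qed.

Lemma mpt_iterS V (a : int) x : mpt_iter V (a + 1) x = V (mpt_iter V a x).
Proof.
case: a => [k|[|k]].
- have -> : Posz k + 1 = Posz k.+1 by lia.
  by [].
- by rewrite /= mpt_invK.
have -> : Negz k.+1 + 1 = Negz k by rewrite !NegzE; lia.
by rewrite /= mpt_invK.
Qed.

Lemma mpt_iterP V (a : int) x :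
  mpt_iter V (a - 1) x = mpt_inv V (mpt_iter V a x).
Proof. by rewrite -[in RHS](subrK 1 a) mpt_iterS mpt_funK. Qed.

Lemma mpt_iterD V (a b : int) x :
  mpt_iter V (a + b) x = mpt_iter V a (mpt_iter V b x).
Proof.
elim/int_rect: a => [|k IH|k IH]; first by rewrite add0r.
  have E : k.+1%:Z = k%:Z + 1 by lia.
  by rewrite E mpt_iterS -IH addrAC mpt_iterS.
have E : - k.+1%:Z = - k%:Z - 1 by lia.
by rewrite E mpt_iterP -IH addrAC mpt_iterP.
Qed.

Lemma mpt_iter_comm V f (a : int) x : (forall y, f (V y) = V (f y)) ->
  f (mpt_iter V a x) = mpt_iter V a (f x).
Proof.
move=> fV; elim/int_rect: a => // k IH.
  have -> : k.+1%:Z = k%:Z + 1 by lia.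
  by rewrite !mpt_iterS fV IH.
have -> : - k.+1%:Z = - k%:Z - 1 by lia.
rewrite !mpt_iterP -IH -[LHS](mpt_funK V); congr (mpt_inv V _).
by rewrite -fV mpt_invK.
Qed.

Variables (n : nat) (U : 'I_n -> invertible_mpt mu).

Lemma measure_preserving_multi_iter j :
  measure_preserving mu (mpt_multi_iter U j).
Proof.
apply: (big_ind (measure_preserving mu)) => [|f g|i _].
- exact: measure_preserving_id.
- exact: measure_preserving_comp.
- exact: measure_preserving_mpt_iter.
Qed.

Lemma measurable_preimage_multi_iter j (A : set T) :
  measurable A -> measurable (mpt_multi_iter U j @^-1` A).
Proof.
move=> mA; rewrite -[X in measurable X]setTI.
by have [mUj _] := measure_preserving_multi_iter j; exact: mUj.
Qed.

Lemma mpt_multi_iter0 x : mpt_multi_iter U 0 x = x.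
Proof.
rewrite /mpt_multi_iter; elim/big_rec: _ => //= i f _ ->.
by rewrite mxE.
Qed.

Hypothesis comm : forall i k x, U i (U k x) = U k (U i x).

(** By commutativity the orbit maps form an action of the lattice, so averages at a point of an
    orbit become averages over translated balls at its base point. *)
Lemma mpt_multi_iterD (j j' : 'rV[int]_n) x :
  mpt_multi_iter U (j + j') x = mpt_multi_iter U j (mpt_multi_iter U j' x).
Proof.
rewrite /mpt_multi_iter; move: (index_enum _) => r; elim: r x => [x|i r IH x].
  by rewrite !big_nil.
rewrite !big_cons /= IH mxE mpt_iterD; congr mpt_iter.
(* It remains to move the power of [U i] past the remaining factors; the inner composite is
   generalized to an arbitrary map [g]. *)
elim: r {IH} (\big[_/_]_(_ <- r) mpt_iter (U _) (j' 0 _)) => [g|k r IH g].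
  by rewrite !big_nil.
rewrite !big_cons /= -IH mpt_iter_comm// => y.
by rewrite -mpt_iter_comm.
Qed.

End action.

Section lattice_ball_translation.
Context {R : realType} {n : nat}.

Lemma lattice_ball_translate (j : 'rV[int]_n) (c : 'rV[R]_n) r :
  lattice_ball (map_mx intr j + c) r =
  [fset (j + i)%R | i in lattice_ball c r]%fset.
Proof.
have E (i : 'rV[int]_n) :
    (j + i \in lattice_ball (map_mx intr j + c) r) = (i \in lattice_ball c r).
  rewrite !mem_lattice_ball; congr (euclidean_norm _ < _).
  by apply/rowP => m; rewrite !mxE intrD; ring.
apply/fsetP => i; apply/idP/imfsetP => /= [ib|[i' i'b ->]]; last by rewrite E.
by exists (i - j); rewrite -?E addrC ?subrK.
Qed.

Lemma mem0_lattice_ball (c : 'rV[R]_n) r :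
  (0 \in lattice_ball c r) = (euclidean_norm c < r).
Proof.
rewrite mem_lattice_ball (_ : map_mx _ _ = 0) ?sub0r ?euclidean_normN//.
by apply/rowP => i; rewrite !mxE.
Qed.

Lemma lattice_ball_sub_centered_box (c : 'rV[R]_n) r (N : nat) :
  euclidean_norm c < r -> 2 * r <= N%:R ->
  (lattice_ball c r `<=` box (const_mx (- N%:Z)) (2 * N).+1)%fset.
Proof.
move=> cr rN; apply/fsubsetP => j; rewrite mem_lattice_ball mem_box => jc.
apply/forallP => i; rewrite mxE.
have jN : `|(j 0 i)%:~R| < N%:R :> R.
  have := euclidean_norm_triangle (map_mx intr j - c) c; rewrite subrK.
  have := coord_le_euclidean_norm (map_mx intr j : 'rV[R]_n) i; rewrite mxE.
  by lra.
move: jN; rewrite -intr_norm pmulrn ltr_int ltr_norml => /andP[j1 j2].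
by set z : int := j 0 i in j1 j2 *; lia.
Qed.

End lattice_ball_translation.

(** * Visits of an orbit to a set, and measurability of the superlevel set *)

Section visits.
Context {d : measure_display} {T : measurableType d} {R : realType}.
Variables (mu : probability T R) (n : nat) (U : 'I_n -> invertible_mpt mu).
Implicit Types (E : set T) (x : T) (F : {fset 'rV[int]_n}) (alpha : R).

Definition visits E x F : {fset 'rV[int]_n} :=
  [fset j in F | mpt_multi_iter U j x \in E]%fset.

Lemma card_visits E x F :
  #|` visits E x F|%:R = \sum_(j <- F) \1_(mpt_multi_iter U j @^-1` E) x :> R.
Proof.
have /perm_size -> : 
    perm_eq (visits E x F) [seq j <- F | mpt_multi_iter U j x \in E].
  apply: uniq_perm; rewrite ?fset_uniq ?filter_uniq ?fset_uniq// => j.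
  by rewrite mem_filter !inE andbC.
rewrite size_filter -sum1_count natr_sum big_mkcond /=; apply: eq_bigr => j _.
have -> : \1_(mpt_multi_iter U j @^-1` E) x =
    (mpt_multi_iter U j x \in E)%:R :> R.
  by rewrite indicE; congr (_%:R); apply/idP/idP => /set_mem/mem_set.
by case: ifP.
Qed.

Lemma ergodic_average_indic (c : 'rV[R]_n) r E x :
  ergodic_average U (euclidean_ball c r) \1_E x =
  #|` visits E x (lattice_ball c r)|%:R / #|` lattice_ball c r|%:R.
Proof.
rewrite /ergodic_average -/(lattice_ball c r) mulrC; congr (_ / _).
rewrite fsbig_finite /=; last exact: finite_lattice_points.
rewrite -/(lattice_ball c r) card_visits; apply: eq_bigr => j _.
by rewrite !indicE ger0_norm.
Qed.

Definition dense_visits alpha E F : set T :=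
  [set x | alpha * #|` F|%:R < #|` visits E x F|%:R].

Lemma measurable_dense_visits alpha E F : measurable E ->
  measurable (dense_visits alpha E F).
Proof.
move=> mE; pose f x : R := \sum_(j <- F) \1_(mpt_multi_iter U j @^-1` E) x.
have mf : measurable_fun [set: T] f.
  apply: measurable_sum => j; apply: measurable_indic.
  exact: measurable_preimage_multi_iter.
have -> : dense_visits alpha E F =
    [set: T] `&` f @^-1` `]alpha * #|` F|%:R, +oo[.
  by apply/seteqP; split => x;
    rewrite /dense_visits /= in_itv /= andbT card_visits ?setTI// => -[].
exact: mf.
Qed.

(** Indexing by finite sets of lattice points instead of balls makes the union countable, hence
    measurable; the box bounds how far an orbit is followed. *)
Definition local_superlevel alpha E (N : nat) : set T :=
  \bigcup_(F in [set F : {fset 'rV[int]_n} |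
      (F `<=` box (const_mx (- N%:Z)) (2 * N).+1)%fset /\
      exists c : 'rV[R]_n,
        exists2 r, euclidean_norm c < r & F = lattice_ball c r])
    dense_visits alpha E F.

Lemma measurable_local_superlevel alpha E N : measurable E ->
  measurable (local_superlevel alpha E N).
Proof.
move=> mE; rewrite /local_superlevel bigcup_mkcond.
apply: countable_bigcupT_measurable => [|F]; first exact: countableP.
by case: ifP => // _; exact: measurable_dense_visits.
Qed.

Lemma nondecreasing_local_superlevel alpha E :
  {homo local_superlevel alpha E : N M / (N <= M)%N >-> (N <= M)%O}.
Proof.
move=> N M NM; apply/subsetPset => x [F [FN Fball] Fx].
exists F => //; split => //.
apply: fsubset_trans FN _; apply/fsubsetP => j; rewrite !mem_box => /forallP jP.
by apply/forallP => i; move: (jP i); rewrite !mxE; lia.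
Qed.

Lemma superlevel_maximal_HLE alpha E : 0 < alpha ->
  [set x | (alpha%:E < maximal_HL U \1_E x)%E] =
  \bigcup_N local_superlevel alpha E N.
Proof.
move=> alpha0; apply/seteqP; split => x /=.
  move=> /ereal_sup_gt[_ [B [B0 [c [r [r0 BE]]]] <-]]; rewrite {}BE in B0 *.
  have cr : euclidean_norm c < r.
    by move: B0; rewrite /euclidean_ball /= sub0r euclidean_normN.
  rewrite ergodic_average_indic lte_fin => ax.
  (* A ball of radius [r] containing the origin stays within distance [2 * r] of it. *)
  exists (Num.trunc (2 * r)).+1 => //; exists (lattice_ball c r); first split.
  - by apply: lattice_ball_sub_centered_box => //; rewrite ltW// truncnS_gt.
  - by exists c, r.
  (* With the convention that [0^-1] is [0], an empty lattice ball would have average 0,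
     contradicting [0 < alpha]. *)
  rewrite /dense_visits /= -ltr_pdivlMr// ltr0n lt0n; apply/eqP => L0.
  by move: ax; rewrite L0 invr0 mulr0 ltNge ltW.
move=> [N _ [_ [_ [c [r cr ->]]]]]; rewrite /dense_visits /= => ax.
have cB : euclidean_ball c r 0.
  by rewrite /euclidean_ball /= sub0r euclidean_normN.
have L0 : (0 < #|` lattice_ball c r|)%N.
  by rewrite cardfs_gt0; apply/fset0Pn; exists 0; rewrite mem0_lattice_ball.
apply: (@lt_le_trans _ _ (ergodic_average U (euclidean_ball c r) \1_E x)%:E).
  by rewrite lte_fin ergodic_average_indic ltr_pdivlMr// ltr0n.
apply: ereal_sup_ubound; exists (euclidean_ball c r) => //; split => //.
by exists c, r; split => //; exact: le_lt_trans (euclidean_norm_ge0 _) cr.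
Qed.

End visits.

(** * The counting inequality along a single orbit *)

Section transference.
Context {d : measure_display} {T : measurableType d} {R : realType}.
Variables (mu : probability T R) (n : nat) (U : 'I_n -> invertible_mpt mu).
Hypothesis n_gt0 : (0 < n)%N.
Hypothesis comm : forall i k x, U i (U k x) = U k (U i x).
Implicit Types (E : set T) (x : T) (F : {fset 'rV[int]_n}).
Implicit Types (alpha : R) (k : nat).

Lemma dense_visits_deficit alpha k E F x :
  (k * (36 * k * n) ^ n)%:R * (1 - alpha) <= 1 -> dense_visits U alpha E F x ->
  (k * (36 * k * n) ^ n * #|` (F `\` visits U E x F)%fset| <= #|` F|)%N.
Proof.
set D := (k * _ ^ n)%N => Dalpha; rewrite /dense_visits /= => ax.
have sub : (visits U E x F `<=` F)%fset.
  by apply/fsubsetP => j; rewrite !inE => /andP[].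
have := fsubset_leq_card sub; rewrite -(ler_nat R).
rewrite cardfsDS// -(ler_nat R) natrM natrB ?fsubset_leq_card// => vF.
have F0 : 0 <= #|` F|%:R :> R by [].
apply: (@le_trans _ _ (D%:R * ((1 - alpha) * #|` F|%:R))).
  by rewrite ler_wpM2l//; lra.
by rewrite mulrA -[leRHS]mul1r ler_wpM2r.
Qed.

(** The discrete estimate applies to the visit times of [x]; the larger box leaves a margin [N] on
    every side for the balls attached to times in [box 0 L]. *)
Lemma visits_local_superlevel_le alpha k E N L x : (1 < k)%N ->
  (k * (36 * k * n) ^ n)%:R * (1 - alpha) <= 1 ->
  (k.-1 ^ n.+1 * #|` visits U (local_superlevel U alpha E N) x (box 0 L)| <=
   k ^ n.+1 * #|` visits U E x (box (const_mx (- N%:Z)) (L + 2 * N))|)%N.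
Proof.
move=> k1 Dalpha.
set A := local_superlevel U alpha E N; set Q := box _ (L + _).
pose P (j : 'rV[int]_n) (b : 'rV[R]_n * R) :=
  [/\ euclidean_norm b.1 < b.2,
      (lattice_ball b.1 b.2 `<=` box (const_mx (- N%:Z)) (2 * N).+1)%fset &
      dense_visits U alpha E (lattice_ball b.1 b.2) (mpt_multi_iter U j x)].
(* At times outside [A] the choice is the dummy [(0, 0)]; [J] contains only visits to [A]. *)
have /boolp.choice[sel selP] j : exists b, mpt_multi_iter U j x \in A -> P j b.
  have [|_] := boolP (_ \in A); last by exists (0, 0).
  by rewrite inE => -[F [FN [c [r cr FE]]] Fx]; exists (c, r); rewrite /P -FE.
pose J := visits U A x (box 0 L).
have JP j : j \in J -> P j (sel j) /\ j \in box 0 L.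
  by rewrite !inE => /andP[jL jA]; split => //; exact: selP.
pose Er := visits U E x Q.
pose s := [seq (map_mx intr j + (sel j).1, (sel j).2) |
  j <- J & (6 * k * n)%:R <= (sel j).2].
have good j : j \in J -> (k * (36 * k * n) ^ n *
    #|` (lattice_ball (map_mx intr j + (sel j).1) (sel j).2 `\` Er)%fset| <=
    #|` lattice_ball (map_mx intr j + (sel j).1) (sel j).2|)%N.
  move=> /JP[[_ FN Fx] jL]; have := dense_visits_deficit Dalpha Fx.
  rewrite lattice_ball_translate; set F := lattice_ball _ _.
  have -> : #|` [fset (j + i)%R | i in F]%fset| = #|` F|.
    by rewrite card_imfset //; exact: addrI.
  apply: leq_trans; rewrite leq_mul2l; apply/orP; right.
  have sub : ([fset (j + i)%R | i in F] `\` Er `<=`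
      [fset (j + i)%R | i in F `\` visits U E (mpt_multi_iter U j x) F])%fset.
    apply/fsubsetP => _ /fsetDP[/imfsetP[i /= iF ->] jiE].
    apply/imfsetP; exists i => //=; rewrite inE iF andbT.
    apply: contra jiE; rewrite !inE => /andP[_ iE].
    rewrite addrC mpt_multi_iterD// iE andbT.
    move/fsubsetP/(_ _ iF): FN; move: jL.
    rewrite !mem_box => /forallP jL /forallP iN.
    apply/forallP => l; move: (jL l) (iN l); rewrite !mxE.
    set u : int := i 0 l; set v : int := j 0 l; lia.
  by rewrite (leq_trans (fsubset_leq_card sub))// leq_imfset_card.
have JU : (J `<=` Er `|` ball_union s)%fset.
  apply/fsubsetP => j jJ; have [[cr FN Fx] jL] := JP _ jJ; rewrite in_fsetU.
  (* A large ball belongs to [s] and covers [j]. A small one has at most [(36kn)^n] points, so its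
     deficit is below 1, hence zero; the origin is then a visit and [j] lies in [Er]. *)
  have [large|small] := leP (6 * k * n)%:R (sel j).2.
    apply/orP; right; apply/ball_unionP.
    exists (map_mx intr j + (sel j).1, (sel j).2).
      by apply/mapP; exists j => //; rewrite mem_filter large.
    by rewrite /= opprD addNKr euclidean_normN.
  have := dense_visits_deficit Dalpha Fx.
  set F := lattice_ball _ _; set V := visits _ _ _ _.
  set D := ((36 * k * n) ^ n)%N => defect.
  have FD : (#|` F| <= D)%N.
    apply: card_lattice_ball_le.
    apply: (@le_trans _ _ (2 * (6 * k * n)%:R + 1)).
      by rewrite lerD2r ler_pM2l// ltW.
    by rewrite -natrM natr1 ler_nat; nia.
  have D0 : (0 < D)%N by rewrite expn_gt0; nia.
  have /cardfs0_eq FV : #|` (F `\` V)%fset| = 0%N.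
    have : (k * #|` (F `\` V)%fset| * D <= 1 * D)%N.
      by rewrite mulnAC mul1n (leq_trans defect).
    by rewrite leq_pmul2r//; nia.
  have F0 : 0 \in F by rewrite mem0_lattice_ball.
  have : 0 \in V.
    by move/fsetP/(_ 0): FV; rewrite !inE F0 andbT => /negbFE.
  rewrite !inE mpt_multi_iter0 => /andP[_ ->]; rewrite andbT.
  apply/orP; left; move: jL; rewrite !mem_box => /forallP jL.
  apply/forallP => l; move: (jL l); rewrite !mxE.
  by set v : int := j 0 l; lia.
have sr b : b \in s -> (6 * k * n)%:R <= b.2.
  by move=> /mapP[j]; rewrite mem_filter => /andP[jr _] ->.
apply: leq_trans (discrete_solyanik n_gt0 k1 sr _).
  by rewrite leq_mul2l fsubset_leq_card ?orbT.
by move=> b /mapP[j]; rewrite mem_filter => /andP[_ /good jJ] ->.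
Qed.

End transference.

(** * Tauberian constants *)

Lemma bernoulli_sub (R : realDomainType) (t : R) m : 0 <= t <= 1 ->
  1 - m%:R * t <= (1 - t) ^+ m.
Proof.
move=> /andP[t0 t1]; elim: m => [|m IH]; first by rewrite mul0r subr0 expr0.
rewrite exprS; apply: le_trans (ler_wpM2l _ IH); last by rewrite subr_ge0.
have : 0 <= m%:R * t * t by rewrite !mulr_ge0.
by rewrite -natr1; lra.
Qed.

(** By convexity the power lies below its chord over [[0, 1]]. *)
Lemma exprD1_le (R : realDomainType) (t : R) m : 0 <= t <= 1 ->
  (1 + t) ^+ m <= 1 + (2 ^+ m - 1) * t.
Proof.
move=> /andP[t0 t1]; elim: m => [|m IH].
  by rewrite !expr0 subrr mul0r addr0.
rewrite exprS; apply: le_trans (ler_wpM2l _ IH) _; first by rewrite addr_ge0.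
rewrite exprS; have : 1 <= 2 ^+ m :> R by rewrite exprn_ege1 ?ler1n.
set p := 2 ^+ m => p1; have : 0 <= (p - 1) * t * (1 - t).
  by rewrite !mulr_ge0 ?subr_ge0.
by lra.
Qed.

Lemma le_of_polynomial_growth (R : archiRealFieldType) (a b : R) (m D : nat) :
  0 <= a -> (forall L : nat, L%:R ^+ m * a <= (L + D)%:R ^+ m * b) -> a <= b.
Proof.
move=> a0 abL; have [D0|D0] := posnP D.
  by have := abL 1%N; rewrite D0 addn0 expr1n !mul1r.
(* With [L = c * D] the ratio [L / (L + D)] is [1 - 1 / (c + 1)], and Bernoulli's inequality bounds
   its power from below. *)
have key (c : nat) : a * (1 - m%:R * c.+1%:R^-1) <= b.
  have c1 : 0 < c.+1%:R :> R by [].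
  have D0R : 0 < D%:R :> R by rewrite ltr0n.
  have := abL (c * D)%N; rewrite -mulSnr !natrM !exprMn mulrAC [leRHS]mulrAC.
  rewrite ler_pM2r ?exprn_gt0// => cb.
  have : (1 - c.+1%:R^-1) ^+ m * a <= b.
    rewrite -(ler_pM2l (exprn_gt0 m c1)) mulrA -exprMn mulrBr mulr1.
    rewrite divff ?gt_eqF//.
    by rewrite -natr1 addrK natr1.
  apply: le_trans; rewrite mulrC ler_wpM2r// bernoulli_sub// invr_ge0 ltW//=.
  by rewrite invf_le1// ler1n.
rewrite leNgt; apply/negP => ba.
have ab0 : 0 < a - b by rewrite subr_gt0.
pose c := Num.trunc (a * m%:R / (a - b)).
have := truncnS_gt (a * m%:R / (a - b)); rewrite -/c ltr_pdivrMr// => hc.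
have := key c; rewrite leNgt => /negP; apply.
rewrite -(ltr_pM2l (ltr0Sn R c)).
rewrite [ltRHS](_ : _ = c.+1%:R * a - a * m%:R); first by lra.
by field; rewrite ?natr1 ?nat1r pnatr_eq0.
Qed.

(** * From orbits to measures by integration *)

Section superlevel_measure.
Context {d : measure_display} {T : measurableType d} {R : realType}.
Variables (mu : probability T R) (n : nat) (U : 'I_n -> invertible_mpt mu).
Hypothesis n_gt0 : (0 < n)%N.
Hypothesis comm : forall i k x, U i (U k x) = U k (U i x).
Implicit Types (E A : set T) (F : {fset 'rV[int]_n}) (alpha : R) (k : nat).

(** By invariance each time in [F] contributes [mu A]. *)
Lemma integral_visits A F : measurable A ->
  (\int[mu]_x (#|` visits U A x F|%:R)%:E = #|` F|%:R%:E * mu A)%E.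
Proof.
move=> mA; under eq_integral do rewrite card_visits -sumEFin.
have mUA j : measurable (mpt_multi_iter U j @^-1` A).
  exact: measurable_preimage_multi_iter.
rewrite ge0_integral_sum => // [|j]; last first.
  by apply/measurable_EFinP; exact: measurable_indic.
rewrite (eq_bigr (fun=> mu A)) => [|j _]; last first.
  rewrite integral_indic// setIT.
  by have [_ pU] := measure_preserving_multi_iter U j; exact: pU.
rewrite -[mu A]fineK ?fin_num_measure// sumEFin -EFinM; congr EFin.
by rewrite big_const_seq count_predT iter_addr addr0 mulr_natl.
Qed.

Lemma measurable_card_visits A F : measurable A ->
  measurable_fun [set: T] (fun x => (#|` visits U A x F|%:R)%:E : \bar R).
Proof.
move=> mA; apply/measurable_EFinP; under eq_fun do rewrite card_visits.
apply: measurable_sum => j; apply: measurable_indic.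
exact: measurable_preimage_multi_iter.
Qed.

(** Integrating the orbit inequality gives the claim with extra factors [L ^ n] and
    [(L + 2 * N) ^ n], whose ratio tends to 1 as [L] grows. *)
Lemma measure_local_superlevel_le alpha k E N : (1 < k)%N ->
  (k * (36 * k * n) ^ n)%:R * (1 - alpha) <= 1 -> measurable E ->
  ((k.-1 ^ n.+1)%:R%:E * mu (local_superlevel U alpha E N) <=
   (k ^ n.+1)%:R%:E * mu E)%E.
Proof.
move=> k1 Dalpha mE; set A := local_superlevel U alpha E N.
have mA : measurable A by exact: measurable_local_superlevel.
rewrite -[mu A]fineK ?fin_num_measure// -[mu E]fineK ?fin_num_measure//.
rewrite -!EFinM lee_fin.
apply: (@le_of_polynomial_growth _ _ _ n (2 * N)).
  by rewrite mulr_ge0// fine_ge0.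
move=> L; rewrite -lee_fin -!natrX mulrCA [in leRHS]mulrCA !EFinM.
rewrite !fineK ?fin_num_measure//.
rewrite -(card_box (0 : 'rV[int]_n) L).
rewrite -(card_box (const_mx (- N%:Z) : 'rV[int]_n) (L + _)).
rewrite -!integral_visits// -!ge0_integralZl_EFin//;
  try exact: measurable_card_visits.
apply: ge0_le_integral; first by [].
- by move=> x _; rewrite mule_ge0 ?lee_fin.
- by apply: measurable_funeM; exact: measurable_card_visits.
- by apply: measurable_funeM; exact: measurable_card_visits.
move=> x _; rewrite -!EFinM lee_fin -!natrM ler_nat.
exact: visits_local_superlevel_le.
Qed.

Lemma measure_superlevel_le alpha k E : (1 < k)%N -> 0 < alpha ->
  (k * (36 * k * n) ^ n)%:R * (1 - alpha) <= 1 -> measurable E ->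
  (mu [set x | (alpha%:E < maximal_HL U \1_E x)%E] <=
   ((k%:R / k.-1%:R) ^+ n.+1)%:E * mu E)%E.
Proof.
move=> k1 alpha0 Dalpha mE; rewrite superlevel_maximal_HLE//.
have mN N : measurable (local_superlevel U alpha E N).
  exact: measurable_local_superlevel.
have := @nondecreasing_cvg_mu _ _ _ mu _ mN
  (bigcupT_measurable _ mN)
  (@nondecreasing_local_superlevel _ _ _ _ _ U alpha E).
move/cvge_to_le; apply; apply: nearW => N /=.
have := measure_local_superlevel_le N k1 Dalpha mE.
have k'0 : 0 < (k.-1 ^ n.+1)%:R :> R by rewrite ltr0n expn_gt0; lia.
rewrite muleC -lee_pdivlMr// => /le_trans; apply.
by rewrite muleAC -EFinM !natrX expr_div_n.
Qed.

Lemma tauberian_HL_le alpha k : (1 < k)%N -> 0 < alpha ->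
  (k * (36 * k * n) ^ n)%:R * (1 - alpha) <= 1 ->
  (tauberian_HL U alpha <= ((k%:R / k.-1%:R) ^+ n.+1)%:E)%E.
Proof.
move=> k1 alpha0 Dalpha; apply: ge_ereal_sup => _ [E [mE E0] <-].
have := measure_superlevel_le k1 alpha0 Dalpha mE.
rewrite -[mu E]fineK ?fin_num_measure// in E0 *.
rewrite inver gt_eqF -?lte_fin// => h; rewrite lee_pdivrMr// -lte_fin//.
Qed.

(** The whole space is the test set: the average of its indicator over the unit ball is 1
    everywhere. *)
Lemma tauberian_HL_ge1 alpha : alpha < 1 -> (1 <= tauberian_HL U alpha)%E.
Proof.
move=> alpha1; apply: ereal_sup_ubound; exists [set: T].
  by split; rewrite // probability_setT.
rewrite probability_setT inve1 mule1 -[RHS](@probability_setT _ _ _ mu).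
congr (mu _).
apply/seteqP; split => // x _ /=.
have B0 : euclidean_ball (0 : 'rV[R]_n) 1 0.
  by rewrite /euclidean_ball /= subrr euclidean_norm0.
apply: (@lt_le_trans _ _
  (ergodic_average U (euclidean_ball 0 1) \1_[set: T] x)%:E).
  rewrite ergodic_average_indic lte_fin.
  rewrite (_ : visits _ _ _ _ = lattice_ball (0 : 'rV[R]_n) 1).
    rewrite divff// pnatr_eq0 cardfs_eq0; apply/fset0Pn; exists 0.
    by rewrite mem0_lattice_ball euclidean_norm0.
  apply/fsetP => j; rewrite !inE; apply/andP/idP => [[]//|jb].
  by split => //; exact/mem_set.
apply: ereal_sup_ubound; exists (euclidean_ball 0 1) => //; split => //.
by exists 0, 1.
Qed.

End superlevel_measure.

(** * Choice of [k] and the quantitative bound *)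

Lemma optimal_dilation_factor (R : realType) (n : nat) (c x : R) :
  (0 < n)%N -> 1 <= c -> 0 < x -> c * x * 3 ^+ n.+1 < 1 ->
  exists2 k : nat, (1 < k)%N & c * k%:R ^+ n.+1 * x <= 1 /\
    (k%:R / k.-1%:R) ^+ n.+1 <=
      1 + 2 ^+ n.+1 * 3 * c * x `^ (n * n.+1)%:R^-1.
Proof.
move=> n0 c1 x0 cx; have c0 : 0 < c by apply: lt_le_trans c1.
have p3 : 1 <= 3 ^+ n.+1 :> R by rewrite exprn_ege1 ?ler1n.
have x1 : x <= 1.
  have : 0 <= (c - 1) * x by rewrite mulr_ge0 ?subr_ge0// ltW.
  have : 0 <= c * x * (3 ^+ n.+1 - 1) by rewrite !mulr_ge0 ?subr_ge0// ltW.
  by lra.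
(* With [k] the integer part of [1 / z], [c * k ^ (n + 1) * x] is [(k * z) ^ (n + 1)], at most 1. *)
pose z := (c * x) `^ n.+1%:R^-1.
have z0 : 0 < z by apply/powR_gt0/mulr_gt0.
have zE : z ^+ n.+1 = c * x.
  rewrite -powR_mulrn ?ltW// /z -powRrM mulVf ?pnatr_eq0// powRr1//.
  by rewrite mulr_ge0 ?ltW.
have z3 : z * 3 < 1.
  rewrite -(@ltr_pXn2r _ n.+1) ?nnegrE ?mulr_ge0// ?ltW//.
  by rewrite exprMn zE expr1n.
(* The error has order [x ^ (1 / (n + 1))]; as [x <= 1] and [1 <= c], it is below
   [c * x ^ (1 / (n * (n + 1)))]. *)
have zc : z <= c * x `^ (n * n.+1)%:R^-1.
  rewrite /z powRM; [|exact: ltW..].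
  apply: ler_pM; rewrite ?powR_ge0//.
    by rewrite ler1_powR// invf_le1// ler1n.
  apply: ger_powR; first by rewrite x0.
  by rewrite lef_pV2 ?posrE ?ltr0n ?muln_gt0 ?n0// ler_nat leq_pmull.
have yz : z * z^-1 = 1 by rewrite divff// gt_eqF.
have y0 : 0 < z^-1 by rewrite invr_gt0.
pose k := Num.trunc z^-1.
have /andP[k1 k2] := truncn_itv (ltW y0); rewrite -/k in k1 k2.
have k3 : (3 <= k)%N.
  by rewrite (truncn_ge_nat _ (ltW y0)) -(ler_pM2l z0) yz ltW.
have kz : k%:R * z <= 1 by rewrite mulrC -[leRHS]yz ler_pM2l.
have k_gt0 : (0 < k)%N by exact: leq_trans k3.
have k'_gt0 : (0 < k.-1)%N by rewrite -ltnS prednK// ltnW.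
exists k; first by exact: ltnW.
split.
  rewrite mulrAC -zE -exprMn exprn_ile1// 1?mulrC//.
  by rewrite mulr_ge0// ltW.
have k'0 : 0 < k.-1%:R :> R by rewrite ltr0n.
have kE : k%:R = k.-1%:R + 1 :> R by rewrite natr1 prednK.
rewrite kE mulrDl divff ?gt_eqF// mul1r.
apply: le_trans (exprD1_le _ _) _.
  by rewrite invr_ge0 ltW//= invf_le1// ler1n.
rewrite lerD2l -!mulrA.
have p2 : 1 <= 2 ^+ n.+1 :> R by rewrite exprn_ege1 ?ler1n.
apply: ler_pM; [by rewrite subr_ge0|by rewrite invr_ge0 ltW|by rewrite gerBl|].
(* From [1 / z < k + 1] and [z < 1/3] follows [z * (k - 1) > 1 - 2z > 1/3]. *)
apply: (@le_trans _ _ (3 * z)); last by rewrite ler_pM2l.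
rewrite -(ler_pM2l k'0) divff ?gt_eqF//.
have : z * z^-1 < z * (k.-1%:R + 2).
  by rewrite ltr_pM2l// (lt_le_trans k2)// -natr1 kE; lra.
by rewrite yz; lra.
Qed.

Lemma tauberian_HL_bound (R : realType) (n : nat) (c : R) :
  (0 < n)%N -> c = ((36 * n) ^ n)%:R ->
  forall (d : measure_display) (T : measurableType d)
         (mu : probability T R) (U : 'I_n -> invertible_mpt mu),
    (forall (i k : 'I_n) (x : T), U i (U k x) = U k (U i x)) ->
    forall alpha : R, (1 + (c * 3 ^+ n.+1)^-1)^-1 < alpha < 1 ->
      (tauberian_HL U alpha <=
        (1 + 2 ^+ n.+1 * 3 * c * (alpha^-1 - 1) `^ (n * n.+1)%:R^-1)%:E)%E.
Proof.
move=> n0 cE d T mu U comm alpha /andP[alpha_gt alpha1].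
have c1 : 1 <= c by rewrite cE ler1n expn_gt0; nia.
have c0 : 0 < c by apply: lt_le_trans c1.
have w0 : 0 < c * 3 ^+ n.+1 by rewrite mulr_gt0 ?exprn_gt0.
have alpha0 : 0 < alpha.
  by apply: lt_trans alpha_gt; rewrite invr_gt0 addr_gt0 ?invr_gt0.
have x0 : 0 < alpha^-1 - 1 by rewrite subr_gt0 invf_gt1.
(* The lower bound imposed on [alpha] is this inequality solved for [alpha]. *)
have cx : c * (alpha^-1 - 1) * 3 ^+ n.+1 < 1.
  rewrite mulrAC mulrC -ltr_pdivlMr// mul1r ltrBlDl.
  by rewrite invf_plt ?posrE// addr_gt0 ?invr_gt0.
have [k k1 [ck kC]] := optimal_dilation_factor n0 c1 x0 cx.
apply: le_trans (tauberian_HL_le n0 comm k1 alpha0 _) _; last first.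
  by rewrite lee_fin.
apply: le_trans ck.
have -> : (k * (36 * k * n) ^ n)%:R = c * k%:R ^+ n.+1.
  rewrite cE -natrX -natrM; congr (_%:R).
  by rewrite mulnAC expnMn mulnCA -expnS.
apply: ler_wpM2l; first by rewrite mulr_ge0 ?exprn_ge0// ltW.
(* This passes from [1 - alpha], which the counting uses, to the larger [1 / alpha - 1] of the final
   bound. *)
rewrite -subr_ge0 (_ : _ - _ = (1 - alpha) ^+ 2 / alpha).
  by rewrite mulr_ge0 ?sqr_ge0// invr_ge0 ltW.
by field; rewrite gt_eqF.
Qed.

Theorem theorem1p10 (R : realType) (n : nat) (n_ge1 : (1 <= n)%N) :
  exists C_n alpha_n : R,
    [/\ 0 < C_n, 0 < alpha_n < 1 &
      forall (d : measure_display) (T : measurableType d)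
             (mu : probability T R) (U : 'I_n -> invertible_mpt mu),
        (forall (i k : 'I_n) (x : T), U i (U k x) = U k (U i x)) ->
        (tauberian_HL U alpha @[alpha --> 1^'-] --> (1%:E : \bar R)) /\
        (forall alpha : R, alpha_n < alpha < 1 ->
          (tauberian_HL U alpha - 1%:E <=
             (C_n * (alpha^-1 - 1) `^ (n * n.+1)%:R^-1)%:E)%E)].
Proof.
pose c : R := ((36 * n) ^ n)%:R.
have c0 : 0 < c by rewrite ltr0n expn_gt0; nia.
have w0 : 0 < (c * 3 ^+ n.+1)^-1 by rewrite invr_gt0 mulr_gt0 ?exprn_gt0.
set w := (c * _)^-1 in w0.
have w1 : (1 + w)^-1 < 1 by rewrite invf_lt1 ?addr_gt0// ltrDl.
exists (2 ^+ n.+1 * 3 * c), (1 + w)^-1; split.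
- by rewrite !mulr_gt0 ?exprn_gt0.
- by rewrite w1 invr_gt0 addr_gt0.
move=> d T mu U comm.
have bound := tauberian_HL_bound n_ge1 erefl comm.
split=> [|alpha /bound ub]; last first.
  by rewrite leeBlDl.
apply: (@squeeze_cvge _ _ _ _ (fun=> 1%:E) _ (fun alpha =>
  (1 + 2 ^+ n.+1 * 3 * c * (alpha^-1 - 1) `^ (n * n.+1)%:R^-1)%:E)).
- near=> alpha.
  have alpha1 : alpha < 1 by near: alpha; exact: nbhs_left_lt.
  rewrite tauberian_HL_ge1//= bound// alpha1 andbT.
  by near: alpha; exact: nbhs_left_gt.
- exact: cvg_cst.
apply: cvg_EFin; first by near=> alpha.
rewrite -[X in _ --> X]addr0 -(mulr0 (2 ^+ n.+1 * 3 * c)).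
apply: cvgD; first exact: cvg_cst.
apply: cvgM; first exact: cvg_cst.
(* As [alpha] tends to 1 from the left, [alpha^-1 - 1] tends to 0 from the right, where a positive
   power tends to 0. *)
apply: (@cvg_comp _ _ _ (fun alpha : R => alpha^-1 - 1)
  (fun a => a `^ (n * n.+1)%:R^-1) _ (0^'+)); last first.
  by apply: powR_cvg0; rewrite invr_gt0 ltr0n muln_gt0 n_ge1.
move=> A [e /= e0 eA].
(* [(1 + e)^-1] is the value of [alpha] at which [alpha^-1 - 1] equals [e]. *)
have e1 : (1 + e)^-1 < 1 by rewrite invf_lt1 ?addr_gt0// ltrDl.
near=> alpha.
have alpha1 : alpha < 1 by near: alpha; exact: nbhs_left_lt.
have alphae : (1 + e)^-1 < alpha by near: alpha; exact: nbhs_left_gt.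
have alpha0 : 0 < alpha by apply: lt_trans alphae; rewrite invr_gt0 addr_gt0.
have x0 : 0 < alpha^-1 - 1 by rewrite subr_gt0 invf_gt1.
apply: eA => //=; rewrite sub0r normrN gtr0_norm// ltrBlDl.
by rewrite invf_plt ?posrE// addr_gt0.
Unshelve. all: by end_near. Qed.
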